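(* Let $n\ge 2$. For any $w,v\in D_n$, $$w\star v \;=\; h_{n-1,\,w\nwarrow (n-1)}\circ h_{n-2,\,w\nwarrow (n-2)}\circ\cdots\circ h_{1,\,w\nwarrow 1}\,(wv),$$ where $wv$ is the usual product (composition) in $D_n$.
   Context: Order $\pm[n]=\{1,\dots,n,-1,\dots,-n\}$ totally by $1<2<\dots<n<-n<\dots<-2<-1$. A signed permutation is a bijection $w$ of $\pm[n]$ with $w(-a)=-w(a)$, written in one-line notation $[w(1),\dots,w(n)]$; it is even if an even number of $w(1),\dots,w(n)$ are negative. $D_n$ is the group of even signed permutations under composition $(uv)(a)=u(v(a))$, with Coxeter generators $s_i$ ($1\le i\le n-1$), the signed permutation exchanging $i$ and $i+1$ and fixing the other elements of $[n]$, and $s_n$, defined by $s_n(n-1)=-n$, $s_n(n)=-(n-1)$, $s_n(a)=a$ for $a\le n-2$. Let $\ell$ be the Coxeter length with respect to $\{s_1,\dots,s_n\}$. The Demazure product $\star$ on $D_n$: for a generator $s$ and $y\in D_n$, $s\star y=sy$ if $\ell(sy)>\ell(y)$ and $s\star y=y$ otherwise; for $x$ with reduced expression $s_{a_1}\cdots s_{a_k}$, $x\star y=s_{a_1}\star(s_{a_2}\star(\cdots(s_{a_k}\star y)))$ (independent of the reduced expression). The unfolding of a signed permutation $u$ is the sequence $u(1),\dots,u(n),-u(n),\dots,-u(1)$. For $t\in\pm[n]$ and an ordered list $L$ of distinct elements of $\pm[n]$, the hopping operator $h_{t,L}$ acts on a signed permutation $u$ as follows: among the elements of $L$ that are greater than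 $t$ (in the total order) and appear to the right of the entry $t$ in the unfolding of $u$, take the one $q$ occurring latest in the list $L$; if there is none, stop; otherwise replace $u$ by the signed permutation whose unfolding is obtained by exchanging the entries $t$ and $q$ and also the entries $-t$ and $-q$ (if $q=-t$, just exchange $t$ and $-t$), and repeat. The output $h_{t,L}(u)$ is a signed permutation (not necessarily even). For $w\in D_n$ and $i\in[n]$, the lifting $w\nwarrow i$ is the list of those entries $x$ of the unfolding of $w$ that lie strictly to the left of the entry $i$ and satisfy $i<x<-i$ in the total order, listed in the order in which they appear. *)

(* Defs.v *)
From mathcomp Require Import all_boot all_fingroup.
From mathcomp Require Import zify.

Set Implicit Arguments.
Unset Strict Implicit.
Unset Printing Implicit Defensive.

(* The set ±[n]: with 0-based ordinals, (i, false) stands for i+1 and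
   (i, true) for -(i+1). *)
Notation pm n := ('I_n * bool)%type.

Section SignedPermutations.

Variable n : nat.
Implicit Types (a b t q : pm n) (u v w x y : {perm pm n}).
Implicit Types (i : 'I_n) (s : seq 'I_n).

Definition pos i : pm n := (i, false).
Definition neg a : pm n := (a.1, ~~ a.2).

(* Position (from 0) in the order 1 < 2 < ... < n < -n < ... < -2 < -1. *)
Definition rank a : nat := if a.2 then n.*2 - a.1.+1 else a.1.
Definition pmlt a b : bool := rank a < rank b.

Definition is_signed w : bool := [forall a, w (neg a) == neg (w a)].

Definition Dn : {set {perm pm n}} :=
  [set w | is_signed w & ~~ odd #|[set i | (w (pos i)).2]|].

(* (scomp u v) a = u (v a): the product of permutations in the library
   composes in the opposite order. *)
Definition scomp u v : {perm pm n} := (v * u)%g.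

(* Exchanges t and q, and -t and -q; applied to values (on the left). *)
Definition exch t q : {perm pm n} :=
  if q == neg t then tperm t q else (tperm t q * tperm (neg t) (neg q))%g.

(* For 2 <= n: gen i is s_(i+1), exchanging i+1 and i+2, if i+1 < n, and
   gen (n-1) is s_n, exchanging n-1 and -n (hence also -(n-1) and n). *)
Definition gen i : {perm pm n} :=
  if i.+1 < n then exch (pos i) (pos (ordS i))
  else exch (pos (ord_pred i)) (neg (pos i)).

Definition word s : {perm pm n} :=
  foldr (fun i y => scomp (gen i) y) 1%g s.

Lemma negK : involutive neg.
Proof. by case=> i b; rewrite /neg /= negbK. Qed.

Lemma neg_neq a : (neg a == a) = false.
Proof. by case: a => i b; apply/eqP => -[]; case: b. Qed.

Lemma scompE u v a : scomp u v a = u (v a).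
Proof. by rewrite permM. Qed.

Lemma scompA u v w : scomp u (scomp v w) = scomp (scomp u v) w.
Proof. by rewrite /scomp mulgA. Qed.

Lemma signedP w : reflect (forall a, w (neg a) = neg (w a)) (is_signed w).
Proof. by apply: (iffP forallP) => H a; apply/eqP. Qed.

Lemma exchE t q a : exch t q a =
  if a == t then q else if a == q then t else
  if a == neg t then neg q else if a == neg q then neg t else a.
Proof.
rewrite /exch; case: (eqVneq q (neg t)) => [->|qt].
  rewrite negK; case: tpermP => [->|->|/eqP /negbTE -> /eqP /negbTE ->] //=.
    by rewrite eqxx.
  by rewrite neg_neq eqxx.
have nt : neg t != q by rewrite eq_sym.
have nq : neg q != t by apply: contra qt => /eqP <-; rewrite negK.
rewrite permM; case: (tpermP t q a) => [->|->|/eqP at_ /eqP aq].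
- by rewrite eqxx tpermD // neg_neq.
- by rewrite eqxx; case: eqP => [->|_]; rewrite tpermD ?neg_neq.
- rewrite (negbTE at_) (negbTE aq).
  by case: tpermP => [->|->|/eqP /negbTE -> /eqP /negbTE ->] //;
    rewrite ?eqxx //; case: eqP => [->|].
Qed.

Lemma exch_signed t q : is_signed (exch t q).
Proof.
apply/signedP => a; rewrite !exchE.
have E b c : (neg b == c) = (b == neg c).
  by rewrite -(inj_eq (can_inj negK)) negK.
rewrite !E !negK.
case: (eqVneq a t) => [->|at_].
  rewrite (eq_sym t (neg t)) neg_neq.
  by case: eqP => [<-|_]; rewrite ?negK.
case: (eqVneq a q) => [->|aq].
  rewrite (eq_sym q (neg q)) neg_neq.
  by case: eqP => [->|_]; rewrite ?negK.
by case: ifP => _; [|case: ifP => _]; rewrite ?negK.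
Qed.

Lemma signed_scomp u v : is_signed u -> is_signed v -> is_signed (scomp u v).
Proof.
by move=> /signedP su /signedP sv; apply/signedP => a; rewrite !scompE sv su.
Qed.

Definition negpar w : bool := \big[addb/false]_i (w (pos i)).2.

Lemma negparE w : odd #|[set i | (w (pos i)).2]| = negpar w.
Proof.
rewrite -sum1_card big_mkcond /= (big_morph odd oddD (erefl _)).
by apply: eq_bigr => i _; rewrite inE; case: (_.2).
Qed.

Lemma signed_snd u a : is_signed u -> (u a).2 = (u (pos a.1)).2 (+) a.2.
Proof.
move=> /signedP su; case: a => i [] /=; last by rewrite addbF.
by rewrite -[(i, true)]/(neg (pos i)) su addbT.
Qed.

Lemma signed_fst_inj u : is_signed u -> injective (fun i => (u (pos i)).1).
Proof.
move=> /signedP su i j E.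
case: (eqVneq (u (pos i)).2 (u (pos j)).2) => E2.
  have /perm_inj [//] : u (pos i) = u (pos j).
  by rewrite [LHS]surjective_pairing E E2 -surjective_pairing.
have /perm_inj [//] : u (pos i) = u (neg (pos j)).
rewrite su [LHS]surjective_pairing E /neg.
by move: E2; case: (_.2); case: (_.2).
Qed.

Lemma negpar_scomp u v : is_signed u -> is_signed v ->
  negpar (scomp u v) = negpar u (+) negpar v.
Proof.
move=> su sv; rewrite /negpar.
rewrite [X in X (+) _](reindex_inj (signed_fst_inj sv)) -big_split /=.
by apply: eq_bigr => i _; rewrite scompE signed_snd.
Qed.

Lemma in_Dn w : (w \in Dn) = is_signed w && ~~ negpar w.
Proof. by rewrite inE negparE. Qed.

Lemma Dn_scomp u v : u \in Dn -> v \in Dn -> scomp u v \in Dn.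
Proof.
rewrite !in_Dn => /andP[su pu] /andP[sv pv].
by rewrite signed_scomp // negpar_scomp // (negbTE pu).
Qed.

Lemma Dn1 : 1%g \in Dn.
Proof.
rewrite in_Dn; apply/andP; split; first by apply/signedP => a; rewrite !perm1.
by rewrite /negpar big1 // => i _; rewrite perm1.
Qed.

Lemma val_ordS i : i.+1 < n -> val (ordS i) = i.+1.
Proof. by move=> H; rewrite /= modn_small. Qed.

Lemma val_ord_pred i : 0 < i -> val (ord_pred i) = i.-1.
Proof.
move=> H /=; have -> : (i + n).-1 = i.-1 + n by lia.
by rewrite modnDr modn_small //; have := ltn_ord i; lia.
Qed.

Lemma pos_eq i j : (pos i == pos j) = (i == j).
Proof. by apply/eqP/eqP => [[->]|->]. Qed.

Lemma pos_neg i j : (pos i == neg (pos j)) = false.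
Proof. by apply/eqP => -[]. Qed.

Lemma genE1 i j : i.+1 < n ->
  gen i (pos j) =
  if j == i then pos (ordS i) else if j == ordS i then pos i else pos j.
Proof. by move=> Hi; rewrite /gen Hi exchE !pos_eq !pos_neg. Qed.

Lemma genE2 i j : i.+1 = n ->
  gen i (pos j) =
  if j == ord_pred i then neg (pos i)
  else if j == i then neg (pos (ord_pred i)) else pos j.
Proof.
by move=> Hi; rewrite /gen Hi ltnn exchE !negK !pos_eq !pos_neg.
Qed.

Lemma gen_Dn i : 1 < n -> gen i \in Dn.
Proof.
move=> n1; rewrite in_Dn; apply/andP; split.
  by rewrite /gen; case: ifP => _; exact: exch_signed.
case: (ltnP i.+1 n) => Hi.
  rewrite /negpar big1 // => j _; rewrite genE1 //.
  by case: ifP => // _; case: ifP.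
have Ei : i.+1 = n by have := ltn_ord i; lia.
have i0 : 0 < i by lia.
have ne : ord_pred i != i.
  by apply/eqP => /(congr1 val); rewrite val_ord_pred //=; lia.
rewrite /negpar (bigD1 i) //= (bigD1 (ord_pred i)) //= !genE2 //.
rewrite !eqxx eq_sym (negbTE ne) /= big1 // => j /andP[/negbTE ji /negbTE jp].
by rewrite genE2 // ji jp.
Qed.

Lemma word_cat s1 s2 : word (s1 ++ s2) = scomp (word s1) (word s2).
Proof.
elim: s1 => [|i s IH] /=; first by rewrite /scomp mulg1.
by rewrite IH scompA.
Qed.

Lemma rank_lt a : rank a < n.*2.
Proof. by case: a => i [] /=; rewrite /rank /=; have := ltn_ord i; lia. Qed.

Lemma rank_neg a : rank (neg a) = n.*2 - (rank a).+1.
Proof. by case: a => i [] /=; rewrite /rank /=; have := ltn_ord i; lia. Qed.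

Lemma rank_inj : injective rank.
Proof.
move=> [i b] [j c]; rewrite /rank /=; have := ltn_ord i; have := ltn_ord j.
by case: b; case: c => /= ? ? E; try lia; congr (_, _); apply: val_inj => /=; lia.
Qed.

Lemma rank_pos a : rank a < n -> a = pos a.1.
Proof. by case: a => i [] //=; rewrite /rank /=; have := ltn_ord i; lia. Qed.

Let M w := \sum_(i < n) (n - i) * rank (w (pos i)).

Lemma M_split w i j : i != j ->
  M w = (n - i) * rank (w (pos i)) + (n - j) * rank (w (pos j)) +
        \sum_(k < n | (k != i) && (k != j)) (n - k) * rank (w (pos k)).
Proof.
move=> ij; rewrite /M (bigD1 i) //= (bigD1 j) /=; last by rewrite eq_sym.
by rewrite addnA.
Qed.

Lemma M_min_lt w i : (forall i, M w <= M (scomp w (gen i))) -> i.+1 < n ->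
  rank (w (pos i)) < rank (w (pos (ordS i))).
Proof.
move=> /(_ i) + Hi.
have ij : i != ordS i.
  by apply/eqP => /(congr1 val); rewrite val_ordS //=; lia.
rewrite !(M_split _ ij) !scompE !genE1 // !eqxx eq_sym (negbTE ij).
rewrite [X in _ <= _ + X](eq_bigr (fun k : 'I_n => (n - k) * rank (w (pos k)))); last first.
  by move=> k /andP[/negbTE ki /negbTE kj]; rewrite scompE genE1 // ki kj.
rewrite leq_add2r val_ordS // => H.
rewrite ltn_neqAle (inj_eq rank_inj) (inj_eq perm_inj) pos_eq ij /=.
have : n - i = (n - i.+1).+1 by lia.
by move: (n - i.+1) (n - i) H => p q H E; subst q; nia.
Qed.

Lemma M_min_neg w i : is_signed w -> (forall i, M w <= M (scomp w (gen i))) ->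
  1 < n -> i.+1 = n ->
  rank (w (pos (ord_pred i))) + rank (w (pos i)) < n.*2.
Proof.
move=> /signedP sw /(_ i) + n1 Hi.
have i0 : 0 < i by lia.
have ij : ord_pred i != i.
  by apply/eqP => /(congr1 val); rewrite val_ord_pred //=; lia.
rewrite !(M_split _ ij) !scompE !genE2 // !eqxx eq_sym (negbTE ij).
rewrite [X in _ <= _ + X](eq_bigr (fun k : 'I_n => (n - k) * rank (w (pos k)))); last first.
  by move=> k /andP[/negbTE ki /negbTE kj]; rewrite scompE genE2 // ki kj.
rewrite leq_add2r val_ord_pred // !sw !rank_neg.
have -> : n - i.-1 = 2 by lia.
have -> : n - i = 1 by lia.
have := rank_lt (w (pos i)); have := rank_lt (w (pos (ord_pred i))).
by lia.
Qed.

Lemma M_min_id w : w \in Dn ->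
  (1 < n -> forall i, M w <= M (scomp w (gen i))) -> w = 1%g.
Proof.
rewrite in_Dn => /andP[sw pw] Hm.
pose r i := rank (w (pos i)).
have r1 i (j : 'I_n) : (j : nat) = i.+1 -> r i < r j.
  move=> E; have Hi : i.+1 < n by rewrite -E; exact: ltn_ord.
  have -> : j = ordS i by apply: val_inj; rewrite val_ordS.
  by apply: M_min_lt => //; apply: Hm; lia.
have rD d : forall i (j : 'I_n), (j : nat) = i + d -> r i + d <= r j.
  elim: d => [|d IH] i j E.
    by rewrite addn0 in E; rewrite addn0 (val_inj E).
  have Hk : i + d < n by have := ltn_ord j; lia.
  have := IH i (Ordinal Hk) erefl.
  by have := r1 (Ordinal Hk) j; rewrite /= E addnS => /(_ erefl); lia.
have rlow i : i.+1 < n -> r i < n.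
  move=> Hi; have Hl : n.-1 < n by lia.
  pose l := Ordinal Hl.
  have El : (l : nat).+1 = n by rewrite /=; lia.
  have n1 : 1 < n by lia.
  have H := M_min_neg sw (Hm n1) n1 El.
  have Ep : (ord_pred l : nat) = n.-2 by rewrite [LHS]val_ord_pred //=; lia.
  have E1 : (ord_pred l : nat) = i + (n.-2 - i) by rewrite Ep; lia.
  have E2 : (l : nat) = (ord_pred l : nat).+1 by rewrite Ep /=; lia.
  have := rD _ _ _ E1; have := r1 _ _ E2.
  by rewrite /r in H *; lia.
have rall i : r i < n.
  case: (ltnP i.+1 n) => [/rlow//|Hi].
  have El : i.+1 = n by have := ltn_ord i; lia.
  have sn : (w (pos i)).2 = negpar w.
    rewrite /negpar (bigD1 i) //= big1 ?addbF // => j ji.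
    have Hj : j.+1 < n.
      have := ltn_ord j; have : val j != val i by [].
      by rewrite /=; lia.
    by have /rank_pos -> := rlow j Hj.
  rewrite /r /rank sn (negbTE pw); exact: ltn_ord.
have rE i : r i = i.
  have Hi := ltn_ord i.
  have H0 : 0 < n by lia.
  have Hl : n.-1 < n by lia.
  have E1 : (Ordinal Hl : nat) = i + (n.-1 - i) by rewrite /=; lia.
  have := rD i (Ordinal H0) i erefl; have := rD _ _ _ E1.
  by have := rall (Ordinal Hl); lia.
have wpos i : w (pos i) = pos i.
  by apply: rank_inj; rewrite -/(r i) rE.
apply/permP => -[i []]; rewrite perm1; last exact: wpos.
by rewrite -[(i, true)]/(neg (pos i)) (signedP _ sw) wpos.
Qed.

Lemma gen_invol i : scomp (gen i) (gen i) = 1%g.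
Proof.
suff exK t q : involutive (exch t q).
  by apply/permP => a; rewrite scompE perm1 /gen; case: ifP => _; rewrite exK.
move=> a; rewrite (exchE t q a).
case: (eqVneq a t) => [->|a1]; first by rewrite exchE eqxx; case: eqP.
case: (eqVneq a q) => [->|a2]; first by rewrite exchE eqxx.
case: (eqVneq a (neg t)) => [E|a3].
  rewrite E (signedP _ (exch_signed t q)) exchE eqxx.
  by case: eqP => [->|].
case: (eqVneq a (neg q)) => [E|a4].
  by rewrite E (signedP _ (exch_signed t q)) exchE eqxx.
by rewrite exchE (negbTE a1) (negbTE a2) (negbTE a3) (negbTE a4).
Qed.

Lemma word_surj w : w \in Dn -> exists s, word s = w.
Proof.
have [m] := ubnP (M w); elim: m w => // m IH w Mw wD.
case: (boolP ((1 < n) && [exists i, M (scomp w (gen i)) < M w])).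
  case/andP=> n1 /existsP[i lti].
  have [] := IH (scomp w (gen i)); first by lia.
    by apply: Dn_scomp => //; exact: gen_Dn.
  move=> s Es; exists (s ++ [:: i]).
  by rewrite word_cat Es /= -scompA (scompA (gen i)) gen_invol /scomp !mul1g.
rewrite negb_and => H; exists [::]; apply/esym/M_min_id => // n1 i.
by move: H; rewrite n1 negb_exists /= => /forallP/(_ i); rewrite -leqNgt.
Qed.

Lemma word_exists w :
  exists k, (w \in Dn) ==> [exists s : k.-tuple 'I_n, word s == w].
Proof.
case: (boolP (w \in Dn)) => [/word_surj[s <-]|_]; last by exists 0.
by exists (size s); apply/existsP; exists (in_tuple s).
Qed.

(* The Coxeter length; the guard [w \in Dn] of [word_exists] only makes it
   total (it is 0 outside Dn). *)
Definition len w : nat := ex_minn (word_exists w).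

Definition reduced w s : bool := (word s == w) && (size s == len w).

Lemma reduced_exists w : exists s, (w \in Dn) ==> reduced w s.
Proof.
rewrite /reduced /len; case: ex_minnP => k; case: (w \in Dn) => /= [H _|_ _].
  by case/existsP: H => s Es; exists s; rewrite Es size_tuple eqxx.
by exists [::].
Qed.

(* An arbitrary reduced expression of w: the Demazure product does not depend
   on this choice. *)
Definition redword w : seq 'I_n := xchoose (reduced_exists w).

Lemma redwordP w : w \in Dn -> reduced w (redword w).
Proof. exact/implyP/(xchooseP (reduced_exists w)). Qed.

Lemma len_min s : word s \in Dn -> len (word s) <= size s.
Proof.
rewrite /len; case: ex_minnP => k _ kmin sD; apply: kmin.
by rewrite sD; apply/existsP; exists (in_tuple s).
Qed.

Definition gen_star i y : {perm pm n} :=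
  if len y < len (scomp (gen i) y) then scomp (gen i) y else y.

Definition demazure x y : {perm pm n} := foldr gen_star y (redword x).

Definition unfolding u : seq (pm n) :=
  [seq u (pos i) | i <- enum 'I_n] ++
  [seq neg (u (pos i)) | i <- rev (enum 'I_n)].

Definition hop_target t (L : seq (pm n)) u : option (pm n) :=
  ohead (rev [seq q <- L | pmlt t q &
                           index t (unfolding u) < index q (unfolding u)]).

Definition hop_step t L u : {perm pm n} :=
  if hop_target t L u is Some q then scomp (exch t q) u else u.

(* Each exchange moves t to the right in the unfolding, which has 2n entries,
   so 2n iterations reach a u without target: see [hop_stop]. *)
Definition hop t L u : {perm pm n} := iter n.*2 (hop_step t L) u.

Definition lifting w i : seq (pm n) :=
  [seq x <- take (index (pos i) (unfolding w)) (unfolding w)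
     | pmlt (pos i) x & pmlt x (neg (pos i))].

Lemma size_unfolding u : size (unfolding u) = n.*2.
Proof. by rewrite /unfolding size_cat !size_map size_rev -!enumT size_enum_ord addnn. Qed.

Lemma unfolding_exch t q u :
  unfolding (scomp (exch t q) u) = map (exch t q) (unfolding u).
Proof.
rewrite /unfolding map_cat -!map_comp; congr (_ ++ _).
  by apply: eq_map => i /=; rewrite scompE.
by apply: eq_map => i /=; rewrite scompE (signedP _ (exch_signed t q)).
Qed.

Lemma index_hop_step t L u q : hop_target t L u = Some q ->
  index t (unfolding u) < index t (unfolding (hop_step t L u)).
Proof.
move=> Hq; rewrite /hop_step Hq unfolding_exch.
have -> : index t (map (exch t q) (unfolding u)) = index q (unfolding u).
  have {1}<- : exch t q q = t by rewrite exchE; case: eqP => // _; rewrite eqxx.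
  by rewrite index_map //; exact: perm_inj.
move: Hq; rewrite /hop_target; set F := filter _ _ => HF.
have : q \in F.
  by rewrite -mem_rev; case: (rev F) HF => //= ? ? [->]; rewrite inE eqxx.
by rewrite mem_filter => /andP[/andP[_ lt_tq] _].
Qed.

Lemma hop_stop t L u : hop_target t L (hop t L u) = None.
Proof.
have H k : hop_target t L (iter k (hop_step t L) u) = None \/
    k <= index t (unfolding (iter k (hop_step t L) u)).
  elim: k => [|k [IH|IH]]; first by right.
    by left; rewrite iterS; set v := iter k _ u in IH *; rewrite /hop_step IH.
  rewrite iterS; set v := iter k _ u in IH *.
  case E: (hop_target t L v) => [q|]; first by right; have := index_hop_step E; lia.
  by left; rewrite /hop_step E E.
case: (H n.*2) => // Hn; rewrite /hop_target.
have -> // : [seq q <- L | pmlt t q & index t (unfolding (hop t L u)) <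
                                   index q (unfolding (hop t L u))] = [::].
rewrite -(filter_pred0 L); apply: eq_filter => q /=.
have := index_size q (unfolding (hop t L u)).
rewrite size_unfolding => Hq.
by rewrite [X in _ && X]ltnNge (leq_trans Hq Hn) andbF.
Qed.

End SignedPermutations.

(* Main.v *)
Require Import Defs.
From mathcomp Require Import all_boot all_fingroup.
From mathcomp Require Import zify.

(* Two facts make the hopping operators tractable. First, [h_{t,L}] is computed
   by a single pass through L from its last element to its first, since an entry
   which is not to the right of t never gets there later. Second, the hops of t
   over a and over -a commute, so that only the relative order of non-opposite
   entries of L matters.

   Suppose that w fixes 1, ..., t-1 but not t. Moving t one step to the left in
   w (two steps across the middle of the unfolding) gives w = u s with s a
   generator and l(w) = l(u) + 1, so that w * v = u * (s * v) for the Demazure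
   product. If x is the entry exchanged with t, then the lifting of w at t is
   that of u followed by x, and the liftings at larger entries are the same, up
   to the order of opposite entries. The hop of t over x maps wv to u(s * v): it
   does nothing if s * v = sv, and it changes wv to uv if s * v = v. The theorem
   follows by induction on t and on the place of t in w.

   That the Demazure product does not depend on the reduced expression is seen
   by letting generators act on the right as well: the left and right Demazure
   actions commute, so the action of a word on y is determined by its action on
   the identity. *)

Set Implicit Arguments.
Unset Strict Implicit.
Unset Printing Implicit Defensive.

(** * Reordering a fold whose operations partly commute *)

(** Entries whose order differs in the two lists act by commuting operations, as in a trace monoid.
    The head x of [L] is moved to the front of [L']: each b standing before it there satisfies
    [r x b] and [r' b x]. Commutation is only asked on states satisfying the invariant [I]. *)
Lemma foldr_trace (T : eqType) (S : Type) (f : T -> S -> S) (I : S -> Prop)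
    (r r' : rel T) (L L' : seq T) z :
  (forall x s, I s -> I (f x s)) ->
  {in L &, forall x y, r x y -> r' y x ->
     forall s, I s -> f x (f y s) = f y (f x s)} ->
  I z -> perm_eq L L' -> pairwise r L -> pairwise r' L' ->
  foldr f z L = foldr f z L'.
Proof.
move=> If + Iz.
have Ifold B : I (foldr f z B) by elim: B => //= b B; exact: If.
elim: L L' => [|x L IH] L' fC; first by rewrite perm_sym => /perm_nilP ->.
move=> pL; have := perm_mem pL x; rewrite inE eqxx => /esym xL'.
case/splitPr: xL' pL => B1 B2 pL /andP[rx rL].
rewrite pairwise_cat /= allrel_consr => /and3P[/andP[r'x r'12] r'1 /andP[_ r'2]].
have pL' : perm_eq L (B1 ++ B2).
  by rewrite -(perm_cons x) (permPl pL) -cat1s perm_catCA.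
rewrite /= (IH (B1 ++ B2)) ?pairwise_cat ?r'12 ?r'1 //; last first.
  by move=> a b aL bL; apply: fC; rewrite inE ?aL ?bL orbT.
have: all (mem L) B1.
  by apply/allP => y yB; rewrite /= (perm_mem pL') mem_cat yB.
rewrite !foldr_cat /=; move: (foldr f z B2) (Ifold B2) => s Is.
elim: B1 r'x {pL r'12 r'1 pL'} => //= b B IHB /andP[r'b r'B] /andP[bL BL].
rewrite -IHB //; apply: fC; rewrite ?inE ?eqxx ?bL ?orbT //.
  exact: (allP rx).
by elim: (B) => //= c C; exact: If.
Qed.

(** * Hopping operators as a single pass through the list *)

Section Hopping.

Variable n : nat.
Implicit Types (a b c d p q t x : pm n) (u v w y z : {perm pm n}).
Implicit Types (i j k : 'I_n) (L : seq (pm n)).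

(** For signed u this is the position of a in the unfolding, which lists the values of u along the
    points in increasing rank ([index_unfolding]). *)
Definition place u a := rank ((u^-1)%g a).

Lemma place_scomp u v a : place (scomp u v) a = place v ((u^-1)%g a).
Proof. by rewrite /place /scomp invMg permM. Qed.

Lemma place_app u a : place u (u a) = rank a.
Proof. by rewrite /place permK. Qed.

Lemma place_inj u : injective (place u).
Proof. by move=> a b /rank_inj /perm_inj. Qed.

Lemma signed_inv u : is_signed u -> is_signed (u^-1)%g.
Proof.
move=> /signedP su; apply/signedP => a; apply: (@perm_inj _ u).
by rewrite su !permKV.
Qed.

Lemma place_neg u a : is_signed u -> place u (neg a) = n.*2 - (place u a).+1.
Proof. by move=> /signed_inv/signedP su; rewrite /place su rank_neg. Qed.

Lemma place_lt u a : place u a < n.*2.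
Proof. exact: rank_lt. Qed.

Lemma index_unfolding u a : is_signed u -> index a (unfolding u) = place u a.
Proof.
move=> /signedP su.
pose E : seq (pm n) := map (@pos n) (enum 'I_n) ++ map (fun i => neg (pos i)) (rev (enum 'I_n)).
have -> : unfolding u = map u E.
  rewrite /unfolding /E map_cat -!map_comp; congr (_ ++ _).
  by apply: eq_map => i /=; rewrite su.
rewrite -{1}(permKV u a) index_map; last exact: perm_inj.
rewrite /place; move: ((u^-1)%g a) => b.
rewrite -(index_map (@rank_inj n)).
have -> : map (@rank n) E = iota 0 n.*2.
  rewrite /E map_cat -addnn iotaD add0n; congr (_ ++ _).
    by rewrite -val_enum_ord -map_comp; apply: eq_map.
  have -> : iota n n = rev (map (fun m => n.*2 - m.+1) (iota 0 n)).
    apply: (@eq_from_nth _ 0); first by rewrite size_rev size_map !size_iota.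
    move=> m; rewrite size_iota => mn.
    rewrite nth_iota // nth_rev ?size_map ?size_iota // (nth_map 0) ?size_iota; last by lia.
    by rewrite nth_iota; lia.
  by rewrite !map_rev -val_enum_ord -!map_comp; congr rev; apply: eq_map => i /=; rewrite /rank.
have -> : rank b = nth 0 (iota 0 n.*2) (rank b) by rewrite nth_iota // rank_lt.
by rewrite index_uniq ?iota_uniq ?size_iota ?nth_iota ?rank_lt.
Qed.

Lemma rank_eq a b : (a == b) = (rank a == rank b).
Proof. by rewrite (inj_eq (@rank_inj n)). Qed.

Lemma place_eq u a b : (a == b) = (place u a == place u b).
Proof. by rewrite (inj_eq (@place_inj u)). Qed.

(** On ranks, identities between exchanges become linear arithmetic. *)
Lemma rank_exch t q a :
  rank (exch t q a) =
  if rank a == rank t then rank q else if rank a == rank q then rank t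
  else if rank a == n.*2 - (rank t).+1 then n.*2 - (rank q).+1
  else if rank a == n.*2 - (rank q).+1 then n.*2 - (rank t).+1 else rank a.
Proof.
by rewrite exchE -!rank_neg -!rank_eq; do 4![case: ifP => // _].
Qed.

Lemma exchK t q : involutive (exch t q).
Proof.
move=> a; apply: rank_inj; rewrite !rank_exch.
have := rank_lt a; have := rank_lt t; have := rank_lt q.
by do !case: ifP; lia.
Qed.

Lemma exchV t q : ((exch t q)^-1)%g = exch t q.
Proof. by apply/permP => a; apply: (@perm_inj _ (exch t q)); rewrite permKV exchK. Qed.

Lemma exchC p q : exch p q = exch q p.
Proof.
apply/permP => a; apply: rank_inj; rewrite !rank_exch.
have := rank_lt a; have := rank_lt p; have := rank_lt q; do !case: ifP => /eqP; lia.
Qed.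

Lemma place_exch t q u a : is_signed u ->
  place (scomp (exch t q) u) a =
  if place u a == place u t then place u q
  else if place u a == place u q then place u t
  else if place u a == n.*2 - (place u t).+1 then n.*2 - (place u q).+1
  else if place u a == n.*2 - (place u q).+1 then n.*2 - (place u t).+1
  else place u a.
Proof.
move=> su; rewrite place_scomp exchV exchE -!(place_neg _ su) -!place_eq.
by do 4![case: ifP => // _].
Qed.

Definition hop1 t q u : {perm pm n} :=
  if pmlt t q && (place u t < place u q) then scomp (exch t q) u else u.

Lemma signed_hop1 t q u : is_signed u -> is_signed (hop1 t q u).
Proof. by rewrite /hop1; case: ifP => // _ su; apply: signed_scomp; rewrite ?exch_signed. Qed.

(** The only entry that could overtake t when t and q are exchanged is -q. That -q is not to the
    right of t means that the places of t and q add up to at least 2n-1; this is symmetric in t and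
    q, so it survives the exchange. *)
Lemma place_hop1 t q u a : is_signed u -> a != neg t -> q != neg t ->
  place u a <= place u t ->
  place (hop1 t q u) a <= place (hop1 t q u) t.
Proof.
move=> su; rewrite !(place_eq u) !place_neg // /hop1.
case: ifP => // /andP[_ tq]; rewrite !place_exch //.
have := place_lt u a; have := place_lt u t; have := place_lt u q.
move: (place u a) (place u t) (place u q) tq => A T Q.
by move=> ? ? ? /eqP ? /eqP ? ?; rewrite eqxx; do !case: ifP => /eqP; lia.
Qed.

Lemma signed_foldr_hop1 t L u : is_signed u -> is_signed (foldr (hop1 t) u L).
Proof. by move=> su; elim: L => //= q L IH; exact: signed_hop1. Qed.

Lemma hop_targetE t L u : is_signed u ->
  hop_target t L u = ohead (rev [seq q <- L | pmlt t q & place u t < place u q]).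
Proof.
move=> su; rewrite /hop_target; congr (ohead (rev _)).
by apply: eq_filter => q /=; rewrite !index_unfolding.
Qed.

Lemma hop_foldr t L u : is_signed u -> neg t \notin L ->
  hop t L u = foldr (hop1 t) u L.
Proof.
move=> su ntL.
have fix_iter z m : hop_target t L z = None -> iter m (hop_step t L) z = z.
  by move=> H; elim: m => //= m ->; rewrite /hop_step H.
(* Invariant of the pass: after the suffix [L2] the state is reached by hop steps, and no entry of
   [L2] above t is still to the right of t. Hence the next entry of the pass, if it qualifies, is
   the target of the next hop step. *)
have H L1 L2 : L = L1 ++ L2 ->
    (exists m, foldr (hop1 t) u L2 = iter m (hop_step t L) u) /\
    (forall q, q \in L2 -> pmlt t q ->
       place (foldr (hop1 t) u L2) q <= place (foldr (hop1 t) u L2) t).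
  elim: L2 L1 => [|q L2 IH] L1 E; first by split=> //; exists 0.
  have [|[m Em] Hle] := IH (rcons L1 q); first by rewrite cat_rcons.
  have sz := signed_foldr_hop1 t L2 su.
  have nq : q != neg t.
    by apply: contraNneq ntL => <-; rewrite E mem_cat inE eqxx orbT.
  rewrite /=; move: (foldr _ _ L2) Em Hle sz => z Em Hle sz; split; last first.
    move=> r; rewrite inE => /orP[/eqP->|rL2] lt_r.
      have [tq|tq] := boolP (place z t < place z q).
        rewrite /hop1 lt_r tq !place_exch // !eqxx.
        by case: eqP => [E'|_]; [rewrite E'|rewrite ltnW].
      by rewrite /hop1 (negbTE tq) andbF leqNgt.
    apply: place_hop1 => //; last exact: Hle.
    by apply: contraNneq ntL => <-; rewrite E mem_cat inE rL2 !orbT.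
  rewrite /hop1; case: ifP => [cq|_]; last by exists m.
  exists m.+1; rewrite iterS -Em /hop_step hop_targetE // E filter_cat /= cq.
  have -> : [seq q0 <- L2 | pmlt t q0 & place z t < place z q0] = [::].
    apply/eqP; rewrite -(negbK (_ == _)) -has_filter; apply/hasPn => r rL.
    by rewrite negb_and -leqNgt -implybE; apply/implyP; exact: Hle.
  by rewrite cats1 rev_rcons.
have [//|[m Em] Hle] := H [::] L _.
have stop : hop_target t L (foldr (hop1 t) u L) = None.
  rewrite hop_targetE ?signed_foldr_hop1 //.
  have -> : [seq q <- L | pmlt t q &
      place (foldr (hop1 t) u L) t < place (foldr (hop1 t) u L) q] = [::].
    apply/eqP; rewrite -(negbK (_ == _)) -has_filter; apply/hasPn => r rL.
    by rewrite negb_and -leqNgt -implybE; apply/implyP; exact: Hle.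
  by [].
(* Both m steps and 2n steps end at a fixed point of [hop_step], so both agree with the result of m
   + 2n steps. *)
rewrite -(fix_iter _ n.*2 stop) Em -iterD addnC iterD.
by rewrite -/(hop t L u) fix_iter // hop_stop.
Qed.

Lemma exchL t q : exch t q t = q.
Proof. by rewrite exchE eqxx. Qed.

Lemma exchR t q : exch t q q = t.
Proof. by rewrite -{2}(exchL t q) exchK. Qed.

Lemma exch_neg t q a : exch t q (neg a) = neg (exch t q a).
Proof. exact: (signedP _ (exch_signed t q)). Qed.

(** Either composite negates t and a and fixes every entry other than these and their opposites. *)
Lemma exch_oppC t a :
  scomp (exch t a) (exch t (neg a)) = scomp (exch t (neg a)) (exch t a).
Proof.
have negE : exch t (neg a) a = neg t by rewrite -{2}(negK a) exch_neg exchR.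
apply/permP => c; rewrite !scompE.
have [->|ct] := eqVneq c t; first by rewrite !exchL exch_neg exchR negE.
have [->|cnt] := eqVneq c (neg t); first by rewrite !exch_neg !exchL exch_neg exchR negE.
have [->|ca] := eqVneq c a; first by rewrite exchR exchL negE exch_neg exchL.
have [->|cna] := eqVneq c (neg a); first by rewrite exchR exchL exch_neg exchR exch_neg exchL negK.
have fixc b : (b == a) || (b == neg a) -> exch t b c = c.
  by case/orP=> /eqP->; rewrite exchE ?negK (negbTE ct) (negbTE ca) (negbTE cnt) (negbTE cna).
by rewrite !fixc ?eqxx ?orbT.
Qed.

Lemma place_scomp_exch t q u a :
  place (scomp (exch t q) u) a = place u (exch t q a).
Proof. by rewrite place_scomp exchV. Qed.

(** Neither hop affects the test of the other. For example, t is to the left of -a when the places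
    of t and a add up to less than 2n-1, a condition unchanged by exchanging t and a. *)
Lemma hop1C t a u : is_signed u -> a != t -> a != neg t ->
  pmlt t a -> pmlt t (neg a) ->
  hop1 t a (hop1 t (neg a) u) = hop1 t (neg a) (hop1 t a u).
Proof.
move=> su + + ta tna; rewrite /hop1 ta tna !(place_eq u) (place_neg t su) /=.
move=> /eqP a1 /eqP a2.
have := place_lt u a; have := place_lt u t.
have [na nt] := (place_neg a su, place_neg t su).
have negE : exch t (neg a) a = neg t by rewrite -{2}(negK a) exch_neg exchR.
case: (ltnP (place u t) (place u a)) => h1;
  case: (ltnP (place u t) (place u (neg a))) => h2 Ht Ha.
- rewrite ?h1 !place_scomp_exch !exchL negE exch_neg exchR.
  by rewrite !ifT ?scompA ?exch_oppC //; lia.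
- by rewrite h1 !place_scomp_exch exchL exch_neg exchR ifF //; lia.
- by rewrite !place_scomp_exch exchL negE ifF //; lia.
- by rewrite ltnNge h1.
Qed.

End Hopping.

(** * Generators, inversions and the Coxeter length *)

Section Length.

Variable n : nat.
Hypothesis n_gt1 : 1 < n.
Implicit Types (a b c d p q t x : pm n) (u v w y z : {perm pm n}).
Implicit Types (i j k : 'I_n) (s : seq 'I_n).

(** With [gq], the entries exchanged by a generator, the smaller one first; this lets s_n be treated
    like the other generators. *)
Definition gp i : pm n := if i.+1 < n then pos i else pos (ord_pred i).
Definition gq i : pm n := if i.+1 < n then pos (ordS i) else neg (pos i).

Lemma gen_exch i : gen i = exch (gp i) (gq i).
Proof. by rewrite /gen /gp /gq; case: ifP. Qed.

Lemma gen_inv i : ((gen i)^-1)%g = gen i.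
Proof. by rewrite gen_exch exchV. Qed.

Lemma signed_gen i : is_signed (gen i).
Proof. by rewrite gen_exch exch_signed. Qed.

Lemma rank_gpq i :
  [/\ i.+1 < n, rank (gp i) = i & rank (gq i) = i.+1] \/
  [/\ i.+1 = n, rank (gp i) = n.-2 & rank (gq i) = n].
Proof.
rewrite /gp /gq; case: ltnP => iN; [left|right].
  by split=> //; rewrite [LHS]val_ordS.
have iE : i.+1 = n by have := ltn_ord i; lia.
by split=> //; [rewrite [LHS]val_ord_pred; lia | rewrite /rank /=; lia].
Qed.

Lemma rank_gp_lt i : rank (gp i) < rank (gq i).
Proof. by case: (rank_gpq i) => -[_ -> ->]; lia. Qed.

Lemma gq_neq i : gq i != neg (gp i).
Proof. by rewrite rank_eq rank_neg; case: (rank_gpq i) => -[? -> ->]; lia. Qed.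

(** A generator reverses one pair of non-opposite entries and the negative of that pair. The
    generator s_n also reverses n, -n and n-1, -(n-1), which is why opposite pairs are excluded. *)
Lemma gen_lt i a b : b != neg a -> rank a < rank b ->
  (rank (gen i b) < rank (gen i a)) =
  ((a, b) == (gp i, gq i)) || ((a, b) == (neg (gq i), neg (gp i))).
Proof.
rewrite !xpair_eqE !rank_eq !rank_neg gen_exch !rank_exch.
have := rank_lt a; have := rank_lt b.
move: (rank a) (rank b) => A B HB HA /eqP.
case: (rank_gpq i) => -[Hi -> ->]; do !case: ifP => /eqP; lia.
Qed.

(** Pairs (a, b) and (-b, -a) stand for the same root of type D, so this set has twice as many
    elements as the length ([double_len]); opposite pairs correspond to no root. *)
Definition invset w : {set pm n * pm n} :=
  [set ab | [&& rank ab.1 < rank ab.2, ab.2 != neg ab.1 & rank (w ab.2) < rank (w ab.1)]].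

(** By [gen_lt] the old inversions persist, and the new ones are the positions in w of [gp i],
    [gq i] and of their negatives. *)
Lemma card_invset_gen i w : is_signed w -> place w (gp i) < place w (gq i) ->
  #|invset (scomp (gen i) w)| = #|invset w|.+2.
Proof.
move=> sw lt_pq; have sV := signedP _ (signed_inv sw).
pose W := (w^-1)%g.
have -> : invset (scomp (gen i) w) =
    (W (gp i), W (gq i)) |: ((W (neg (gq i)), W (neg (gp i))) |: invset w).
  apply/setP => -[a b]; rewrite !inE /= !scompE.
  have E c d : ((a, b) == (W c, W d)) = ((w a, w b) == (c, d)).
    by rewrite !xpair_eqE -(inj_eq (@perm_inj _ w) a) -(inj_eq (@perm_inj _ w) b) !permKV.
  rewrite !E.
  have nE : (b != neg a) = (w b != neg (w a)).
    by rewrite -(signedP _ sw) (inj_eq (@perm_inj _ w)).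
  have pE : (rank a < rank b) = (place w (w a) < place w (w b)).
    by rewrite !place_app.
  rewrite nE pE; have := place_lt w (gp i); have := place_lt w (gq i).
  have := gq_neq i; have := place_neg (gp i) sw; have := place_neg (gq i) sw.
  move: (w a) (w b) => {nE pE E}c d nq np npq Hq Hp.
  have np' : neg (gp i) != neg (neg (gq i)).
    by rewrite negK eq_sym.
  have [lt_cd|le_dc] := ltnP (place w c) (place w d); last first.
    rewrite !orbF !xpair_eqE; apply/esym/negbTE; rewrite negb_or; apply/andP.
    by split; apply/negP => /andP[/eqP cE /eqP dE]; move: le_dc; rewrite cE dE; lia.
  rewrite orbA; have [dE|ncd] := eqVneq d (neg c).
    rewrite orbF !xpair_eqE; apply/esym/negbTE; rewrite negb_or; apply/andP.
    split; apply/negP => /andP[/eqP cE /eqP dE'].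
      by move: npq; rewrite -dE' dE cE eqxx.
    by move: np'; rewrite -dE' dE cE eqxx.
  have [lt_r|] := ltnP (rank d) (rank c); last first.
    rewrite leq_eqVlt -rank_eq => /orP[/eqP cd|lt_r].
      by move: lt_cd; rewrite cd ltnn.
    by rewrite orbF /= gen_lt.
  have ndc : c != neg d by apply: contra ncd => /eqP ->; rewrite negK.
  rewrite orbT /= ltn_neqAle -rank_eq (inj_eq (@perm_inj _ _)).
  rewrite leqNgt gen_lt // !xpair_eqE; apply/andP; split.
    by apply: contraTneq lt_r => ->; rewrite ltnn.
  rewrite negb_or; apply/andP.
  by split; apply/negP => /andP[/eqP dE /eqP cE]; move: lt_cd; rewrite cE dE; lia.
have rk := rank_gp_lt i.
have rq := rank_lt (gq i).
rewrite !cardsU1 !inE /= !permKV !rank_neg.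
have -> : (rank (gq i) < rank (gp i)) = false by lia.
have -> : (n.*2 - (rank (gp i)).+1 < n.*2 - (rank (gq i)).+1) = false by lia.
rewrite !andbF orbF xpair_eqE !(inj_eq (@perm_inj _ _)).
suff -> : gp i == neg (gq i) = false by [].
by apply/negbTE; apply: contra (gq_neq i) => /eqP ->; rewrite negK.
Qed.

(** The map (a, b) to (w b, w a) carries inversions of w to inversions of its inverse. This
    transfers the results on left multiplication to right multiplication. *)
Lemma card_invsetV w : is_signed w -> #|invset (w^-1)%g| = #|invset w|.
Proof.
move=> sw; have sV := signedP _ (signed_inv sw).
pose f (ab : pm n * pm n) := (w ab.2, w ab.1).
have fI : injective f by move=> [a b] [c d] [/perm_inj-> /perm_inj->].
rewrite -[RHS](card_imset _ fI); congr #|pred_of_set _|; apply/setP => -[c d].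
have -> : (c, d) = f ((w^-1)%g d, (w^-1)%g c) by rewrite /f /= !permKV.
rewrite (mem_imset _ _ fI) !inE /= !permKV -sV (inj_eq (@perm_inj _ _)).
rewrite [RHS]andbA [RHS]andbC [X in _ = _ && X]andbC; congr (_ && (~~ _ && _)).
by apply/eqP/eqP => ->; rewrite negK.
Qed.

Lemma Dn_signed w : w \in Dn n -> is_signed w.
Proof. by rewrite in_Dn => /andP[]. Qed.

Lemma Dn_gen i : gen i \in Dn n.
Proof. exact: gen_Dn. Qed.

Lemma scompgK i w : scomp (gen i) (scomp (gen i) w) = w.
Proof. by rewrite scompA gen_invol /scomp mulg1. Qed.

Lemma scompKg i w : scomp (scomp w (gen i)) (gen i) = w.
Proof. by rewrite -scompA gen_invol /scomp mul1g. Qed.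

(** A generator that is not a right descent does not lower the weighted sum of ranks whose
    minimality characterizes the identity in [M_min_id]. *)
Lemma no_descent_id w : w \in Dn n ->
  (forall i, rank (w (gp i)) < rank (w (gq i))) -> w = 1%g.
Proof.
move=> wD H; apply: M_min_id => // _ i; have := H i.
have sw := signedP _ (Dn_signed wD).
rewrite /gp /gq; case: ifP => iN.
  have ij : i != ordS i by apply/eqP => /(congr1 val); rewrite val_ordS //=; lia.
  rewrite !(M_split _ ij) !scompE !genE1 // !eqxx eq_sym (negbTE ij).
  rewrite [X in _ -> _ <= _ + X](eq_bigr (fun k : 'I_n => (n - k) * rank (w (pos k)))).
    by rewrite leq_add2r val_ordS // -(subnSK (ltn_ord i)); move: (n - i.+1) => m; nia.
  by move=> k /andP[/negbTE ki /negbTE kj]; rewrite scompE genE1 // ki kj.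
have iE : i.+1 = n by have := ltn_ord i; lia.
have ij : ord_pred i != i.
  by apply/eqP => /(congr1 val); rewrite val_ord_pred //=; lia.
rewrite !(M_split _ ij) !scompE !genE2 // !eqxx eq_sym (negbTE ij).
rewrite [X in _ -> _ <= _ + X](eq_bigr (fun k : 'I_n => (n - k) * rank (w (pos k)))).
  rewrite leq_add2r val_ord_pred ?sw ?rank_neg; last by lia.
  have -> : n - i.-1 = 2 by lia.
  have -> : n - i = 1 by lia.
  by have := rank_lt (w (pos i)); have := rank_lt (w (pos (ord_pred i))); lia.
by move=> k /andP[/negbTE ki /negbTE kj]; rewrite scompE genE2 // kj ki.
Qed.

Lemma gen_gp i : gen i (gp i) = gq i.
Proof. by rewrite gen_exch exchL. Qed.

Lemma gen_gq i : gen i (gq i) = gp i.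
Proof. by rewrite gen_exch exchR. Qed.

Lemma place_gen_le i w : place w (gq i) <= place w (gp i) ->
  place (scomp (gen i) w) (gp i) < place (scomp (gen i) w) (gq i).
Proof.
rewrite !place_scomp gen_inv gen_gp gen_gq leq_eqVlt => /orP[/eqP/place_inj E|//].
by have := rank_gp_lt i; rewrite E ltnn.
Qed.

Lemma card_invset_gen_iff i w : is_signed w ->
  (place w (gp i) < place w (gq i)) = (#|invset w| < #|invset (scomp (gen i) w)|).
Proof.
move=> sw; case: ltnP => [/(card_invset_gen sw)->|/place_gen_le]; first by lia.
by move/card_invset_gen; rewrite scompgK signed_scomp ?signed_gen // => ->; lia.
Qed.

Lemma card_invset_gen_le i w : is_signed w ->
  #|invset (scomp (gen i) w)| <= #|invset w|.+2.
Proof.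
move=> sw; have := card_invset_gen_iff i sw.
by have [/(card_invset_gen sw)->|_ /esym/negbT] := ltnP; lia.
Qed.

Lemma card_invset_scompV i w : is_signed w ->
  #|invset (scomp (gen i) w^-1)| = #|invset (scomp w (gen i))|.
Proof.
move=> sw; rewrite -[RHS]card_invsetV ?signed_scomp ?signed_gen //.
by rewrite /scomp invMg gen_inv.
Qed.

Lemma card_invset_genr i w : is_signed w -> rank (w (gp i)) < rank (w (gq i)) ->
  #|invset (scomp w (gen i))| = #|invset w|.+2.
Proof.
move=> sw lt_pq; rewrite -card_invset_scompV // card_invset_gen ?signed_inv //.
  by rewrite card_invsetV.
by rewrite /place invgK.
Qed.

Lemma card_invset_genr_iff i w : is_signed w ->
  (rank (w (gp i)) < rank (w (gq i))) = (#|invset w| < #|invset (scomp w (gen i))|).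
Proof.
move=> sw; have := card_invset_gen_iff i (signed_inv sw).
by rewrite card_invset_scompV // card_invsetV // /place invgK.
Qed.

Lemma card_invset_genr_le i w : is_signed w ->
  #|invset (scomp w (gen i))| <= #|invset w|.+2.
Proof.
move=> sw; have := card_invset_gen_le i (signed_inv sw).
by rewrite card_invset_scompV // card_invsetV.
Qed.

Lemma Dn_word s : word s \in Dn n.
Proof. by elim: s => [|i s IH]; [exact: Dn1 | apply: Dn_scomp IH; exact: Dn_gen]. Qed.

Lemma card_invset1 : #|invset 1| = 0.
Proof.
apply: eq_card0 => -[a b]; rewrite !inE /= !perm1.
by apply/negP => /and3P[]; lia.
Qed.

Lemma card_invset_word s : #|invset (word s)| <= (size s).*2.
Proof.
elim: s => [|i s IH] /=; first by rewrite card_invset1.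
by apply: leq_trans (card_invset_gen_le i (Dn_signed (Dn_word s))) _; rewrite doubleS !ltnS.
Qed.

Lemma descent_exists w : w \in Dn n -> w != 1%g ->
  exists i, rank (w (gq i)) < rank (w (gp i)).
Proof.
move=> wD w1; apply/existsP; rewrite -(negbK [exists _, _]) negb_exists.
apply: contra w1 => /forallP H; apply/eqP/no_descent_id => // i.
have := H i; rewrite -leqNgt leq_eqVlt -rank_eq (inj_eq (@perm_inj _ _)) rank_eq.
by have := rank_gp_lt i; case: eqP => // ->; rewrite ltnn.
Qed.

(** Removing right descents lowers the number of inversions until the identity is reached. *)
Lemma Dn_ind (P : {perm pm n} -> Prop) : P 1%g ->
  (forall w i, w \in Dn n -> rank (w (gp i)) < rank (w (gq i)) -> P w ->
     P (scomp w (gen i))) ->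
  forall w, w \in Dn n -> P w.
Proof.
move=> P1 PS w; have [m] := ubnP #|invset w|; elim: m w => // m IH w wm wD.
have [->//|w1] := eqVneq w 1%g.
have [i lt_i] := descent_exists wD w1.
have uD : scomp w (gen i) \in Dn n by apply: Dn_scomp => //; exact: Dn_gen.
have lt_u : rank (scomp w (gen i) (gp i)) < rank (scomp w (gen i) (gq i)).
  by rewrite !scompE gen_gp gen_gq.
rewrite -(scompKg i w); apply: PS => //; apply: IH => //.
by have := card_invset_genr (Dn_signed uD) lt_u; rewrite scompKg; lia.
Qed.

(** One letter adds at most two inversions, and [Dn_ind] builds a word each of whose letters adds
    exactly two. *)
Lemma double_len w : w \in Dn n -> (len w).*2 = #|invset w|.
Proof.
move=> wD; apply/eqP; rewrite eqn_leq; apply/andP; split; last first.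
  by have /andP[/eqP wE /eqP <-] := redwordP wD; rewrite -{1}wE card_invset_word.
suff [s <- <-] : exists2 s, word s = w & (size s).*2 = #|invset w|.
  by rewrite leq_double len_min ?Dn_word.
elim/Dn_ind: wD => [|{}w i wD lt_i [s sE cE]].
  by exists [::]; rewrite ?card_invset1.
exists (s ++ [:: i]).
  by rewrite word_cat sE /= /scomp mul1g.
by rewrite card_invset_genr ?Dn_signed // size_cat addn1 doubleS cE.
Qed.

(** * The left and right Demazure actions *)

Lemma gen_starE i y : y \in Dn n -> gen_star i y =
  if place y (gp i) < place y (gq i) then scomp (gen i) y else y.
Proof.
move=> yD; rewrite /gen_star -ltn_double !double_len ?Dn_scomp ?Dn_gen //.
by rewrite card_invset_gen_iff ?Dn_signed.
Qed.

(** The right-handed counterpart of [gen_star], with the length test already replaced by a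
    comparison of ranks. *)
Definition star_gen i y : {perm pm n} :=
  if rank (y (gp i)) < rank (y (gq i)) then scomp y (gen i) else y.


Lemma Dn_gen_star i y : y \in Dn n -> gen_star i y \in Dn n.
Proof. by rewrite /gen_star; case: ifP => // _; apply: Dn_scomp; exact: Dn_gen. Qed.

Lemma Dn_star_gen i y : y \in Dn n -> star_gen i y \in Dn n.
Proof.
by rewrite /star_gen; case: ifP => // _ yD; apply: Dn_scomp => //; exact: Dn_gen.
Qed.

Lemma exch_conj y a b c : is_signed y -> y (exch a b c) = exch (y a) (y b) (y c).
Proof.
move=> /signedP sy; rewrite !exchE -!sy !(inj_eq (@perm_inj _ y)).
by do 4![case: ifP => // _].
Qed.

Lemma exchNN p q : q != neg p -> exch (neg q) (neg p) = exch p q.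
Proof.
rewrite rank_eq rank_neg => /eqP qp; apply/permP => a; apply: rank_inj.
rewrite !rank_exch !rank_neg; have := rank_lt a.
have := rank_lt p; have := rank_lt q; do !case: ifP => /eqP; lia.
Qed.

Lemma star_genC i j y : y \in Dn n ->
  gen_star i (star_gen j y) = star_gen j (gen_star i y).
Proof.
move=> yD; rewrite !gen_starE ?Dn_star_gen //.
have sy := Dn_signed yD.
have sl : is_signed (scomp (gen i) y) by rewrite signed_scomp ?signed_gen.
have sr : is_signed (scomp y (gen j)) by rewrite signed_scomp ?signed_gen.
rewrite /star_gen.
case: (ltnP (place y (gp i))) => [L|nL]; case: (ltnP (rank (y (gp j)))) => [R|nR].
(* Both multiplications lengthen y by the same amount, so the two remaining tests both compare that
   length with the length of the two-sided product. *)
- have cl := card_invset_gen sy L.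
  have cr := card_invset_genr sy R.
  have condE : (place (scomp y (gen j)) (gp i) < place (scomp y (gen j)) (gq i)) =
      (rank (scomp (gen i) y (gp j)) < rank (scomp (gen i) y (gq j))).
    by rewrite card_invset_gen_iff // card_invset_genr_iff // cl cr scompA.
  rewrite -condE; case: ifP => [_|/negbT]; first by rewrite scompA.
  (* If the tests fail, [gen j] reverses the positions of [gp i] and [gq i] in y. These are then the
     pair of [gen j] or its negative, so conjugation by y turns [gen j] into [gen i] and the two
     one-sided products coincide. *)
  rewrite -leqNgt leq_eqVlt -place_eq => /orP[/eqP E|].
    by have := rank_gp_lt i; rewrite E ltnn.
  have sV := signedP _ (signed_inv sy).
  rewrite !place_scomp /place gen_inv gen_lt; last by exact: L.
    suff conj a b : exch a b = gen j -> y a = gp i -> y b = gq i ->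
        scomp y (gen j) = scomp (gen i) y.
      rewrite !xpair_eqE => /orP[] /andP[/eqP ab /eqP bb].
        by apply: (conj (gp j) (gq j)); rewrite -?gen_exch -?ab -?bb ?permKV.
      apply: (conj (neg (gq j)) (neg (gp j))); rewrite -?ab -?bb ?permKV //.
      by rewrite ab bb exchNN ?gq_neq // gen_exch.
    move=> <- ya yb; apply/permP => c.
    by rewrite !scompE exch_conj // ya yb gen_exch.
  by rewrite -sV (inj_eq (@perm_inj _ _)) gq_neq.
(* Here y [gen j] has no more inversions than y, so the two-sided product has no more than [gen i]
   y: the right action still does nothing. The next case is the mirror image. *)
- rewrite ?L ifF // card_invset_genr_iff //.
  have := card_invset_gen sy L; have := card_invset_genr_le j sy.
  have := card_invset_gen_le i sr.
  have := card_invset_genr_iff j sy; rewrite ltnNge nR /= -scompA; lia.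
- rewrite ?R ifF // card_invset_gen_iff //.
  have := card_invset_genr sy R; have := card_invset_gen_le i sy.
  have := card_invset_genr_le j sl.
  have := card_invset_gen_iff i sy; rewrite ltnNge nL /= scompA; lia.
by rewrite ltnNge nL.
Qed.

Lemma star_gen_word y : y \in Dn n -> exists s, y = foldr star_gen 1%g s.
Proof.
move: y; apply: Dn_ind => [|w i wD lt_i [s sE]]; first by exists [::].
by exists (i :: s); rewrite /= -sE /star_gen lt_i.
Qed.

Lemma Dn_foldr_star_gen y s : y \in Dn n -> foldr star_gen y s \in Dn n.
Proof. by move=> yD; elim: s => //= i s; exact: Dn_star_gen. Qed.

Lemma foldr_gen_starC y s r : y \in Dn n ->
  foldr (@gen_star n) (foldr star_gen y r) s =
  foldr star_gen (foldr (@gen_star n) y s) r.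
Proof.
move=> yD; elim: s => //= i s ->.
have: foldr (@gen_star n) y s \in Dn n.
  by elim: s => //= k s; exact: Dn_gen_star.
move: (foldr _ y s) => z zD; elim: r => //= j r <-.
by rewrite star_genC ?Dn_foldr_star_gen.
Qed.

Lemma foldr_gen_star1 s : (size s).*2 = #|invset (word s)| ->
  foldr (@gen_star n) 1%g s = word s.
Proof.
elim: s => // i s IH cE.
have := card_invset_gen_le i (Dn_signed (Dn_word s)).
have := card_invset_word s; rewrite -[scomp _ _]/(word (i :: s)) -cE doubleS !ltnS => le1 le2.
(* The two bounds force equality for s: a suffix of a reduced word is reduced. *)
have {}IH := IH (esym (anti_leq (introT andP (conj le1 le2)))).
rewrite /= IH gen_starE ?Dn_word // card_invset_gen_iff ?Dn_signed ?Dn_word // ifT //.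
by rewrite -[scomp _ _]/(word (i :: s)) -cE doubleS ltnS ltnW.
Qed.

(* Commuting the word past the right factorization of y reduces to y = 1. *)
Lemma foldr_gen_star_word s1 s2 y : y \in Dn n ->
  (size s1).*2 = #|invset (word s1)| -> (size s2).*2 = #|invset (word s2)| ->
  word s1 = word s2 ->
  foldr (@gen_star n) y s1 = foldr (@gen_star n) y s2.
Proof.
move=> /star_gen_word[r ->] c1 c2 E.
by rewrite !foldr_gen_starC ?Dn1 // !foldr_gen_star1 // E.
Qed.

(** Appending i to a reduced word of u gives a reduced word of the longer product, and all its
    reduced words act alike. *)
Lemma demazure_gen i u v : u \in Dn n -> v \in Dn n ->
  rank (u (gp i)) < rank (u (gq i)) ->
  demazure (scomp u (gen i)) v = demazure u (gen_star i v).
Proof.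
move=> uD vD lt_i; have wD : scomp u (gen i) \in Dn n by rewrite Dn_scomp ?Dn_gen.
have /andP[/eqP uE /eqP uS] := redwordP uD.
have /andP[/eqP wE /eqP wS] := redwordP wD.
have gE : word [:: i] = gen i by rewrite /= /scomp mul1g.
rewrite /demazure -[gen_star i v]/(foldr (@gen_star n) v [:: i]) -foldr_cat.
apply: foldr_gen_star_word => //; rewrite ?word_cat ?gE ?wE ?uE //.
  by rewrite wS double_len.
by rewrite size_cat addn1 doubleS uS double_len // card_invset_genr // Dn_signed.
Qed.

Lemma demazure1 v : demazure 1%g v = v.
Proof.
have /andP[_] := redwordP (Dn1 n); rewrite /demazure.
suff -> : len (1 : {perm pm n})%g = 0 by case: redword.
by apply/eqP; rewrite -double_eq0 double_len ?Dn1 // card_invset1.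
Qed.

End Length.

(** * Liftings and their admissible rearrangements *)

Section Lifting.

Variable n : nat.
Implicit Types (a b c d p q t x : pm n) (u v w y z : {perm pm n}).
Implicit Types (i j : 'I_n) (L : seq (pm n)) (k : nat).

Lemma mem_unfolding w a : is_signed w -> a \in unfolding w.
Proof. by move=> sw; rewrite -index_mem size_unfolding index_unfolding ?place_lt. Qed.

Lemma uniq_unfolding w : is_signed w -> uniq (unfolding w).
Proof.
move=> sw; apply: (@leq_size_uniq _ (enum {: pm n})); first exact: enum_uniq.
  by move=> a _; exact: mem_unfolding.
by rewrite size_unfolding -cardE card_prod card_ord card_bool muln2.
Qed.

Lemma lifting_subseq w i : subseq (lifting w i) (unfolding w).
Proof. exact: subseq_trans (filter_subseq _ _) (take_subseq _ _). Qed.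

Lemma uniq_lifting w i : is_signed w -> uniq (lifting w i).
Proof. by move=> sw; exact: subseq_uniq (lifting_subseq w i) (uniq_unfolding sw). Qed.

Lemma pairwise_lifting w i : is_signed w ->
  pairwise (fun a b => place w a < place w b) (lifting w i).
Proof.
move=> sw; apply: subseq_pairwise (lifting_subseq w i) _.
apply/(pairwiseP (pos i)) => k l; rewrite !inE => Hk Hl.
by rewrite -!(index_unfolding _ sw) !index_uniq // uniq_unfolding.
Qed.

Lemma mem_lifting w i a : is_signed w -> (a \in lifting w i) =
  [&& i < rank a < n.*2 - i.+1 & place w a < place w (pos i)].
Proof.
move=> sw; rewrite mem_filter in_take ?mem_unfolding // !index_unfolding //.
Qed.

Lemma neg_notin_lifting w i : is_signed w -> neg (pos i) \notin lifting w i.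
Proof. by move=> sw; rewrite mem_lifting // rank_neg ltnn andbF. Qed.

Lemma signed_hop t L z : is_signed z -> is_signed (hop t L z).
Proof.
rewrite /hop => sz; elim: n.*2 => //= m sm; rewrite /hop_step.
by case: hop_target => // q; rewrite signed_scomp ?exch_signed.
Qed.

(** This is [foldr_trace]: by the last hypothesis only opposite entries can be ordered differently
    in the lifting and in [L], and their hops commute by [hop1C]. *)
Lemma hop_lifting w i z L (r : rel (pm n)) : is_signed w -> is_signed z ->
  perm_eq (lifting w i) L -> pairwise r L ->
  {in lifting w i &, forall a b, place w a < place w b -> r b a -> b = neg a} ->
  hop (pos i) (lifting w i) z = foldr (hop1 (pos i)) z L.
Proof.
move=> sw sz pL rL H; rewrite hop_foldr ?neg_notin_lifting //.
apply: (foldr_trace (I := @is_signed n)) pL (pairwise_lifting i sw) rL => //.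
  by move=> a y; exact: signed_hop1.
move=> a b aL bL lt_ab rba y sy; have bE := H a b aL bL lt_ab rba; subst b.
move: aL bL; rewrite !mem_lifting // => /andP[/andP[a1 a2] _] /andP[/andP[a3 a4] _].
by apply: hop1C; rewrite // rank_eq ?rank_neg /=; apply/eqP; rewrite /rank /= in a1 a2 *; lia.
Qed.

Lemma fixed_app w k a : k <= n -> (forall j, j < k -> w (pos j) = pos j) ->
  rank a < k -> w a = a.
Proof.
move=> kn fixw ak; have aE := rank_pos (leq_trans ak kn).
by rewrite aE fixw // -[X in X < _]/(rank (pos a.1)) -aE.
Qed.

Lemma fixed_place w k a : k <= n -> (forall j, j < k -> w (pos j) = pos j) ->
  (place w a < k) = (rank a < k).
Proof.
move=> kn fixw; have fixa b := fixed_app (a := b) kn fixw.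
apply/idP/idP => H; last by rewrite /place -{1}(fixa _ H) permK.
by have := fixa _ H; rewrite permKV => E; rewrite E.
Qed.

Lemma ord_filterS k (kn : k.+1 < n) :
  [seq i : 'I_n <- enum 'I_n | k <= i & i.+1 < n] =
  Ordinal (ltnW kn) :: [seq i : 'I_n <- enum 'I_n | k < i & i.+1 < n].
Proof.
have tr : transitive (fun i j : 'I_n => i < j) by move=> ? ? ?; exact: ltn_trans.
have so : sorted (fun i j : 'I_n => i < j) (enum 'I_n).
  by have := iota_ltn_sorted 0 n; rewrite -val_enum_ord sorted_map.
apply: (irr_sorted_eq tr) => [i|||i]; first by rewrite ltnn.
- exact: sorted_filter.
- rewrite /= path_sortedE // sorted_filter // andbT.
  by apply/allP => i; rewrite mem_filter => /andP[/andP[]].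
- rewrite inE !mem_filter -!enumT !mem_enum !andbT -val_eqE /=; lia.
Qed.

End Lifting.

(** * Moving an entry one step to the left *)

Section Main.

Variable n : nat.
Hypothesis n_gt1 : 1 < n.
Implicit Types (a b c d p q t x A B P Q : pm n) (u v w y z : {perm pm n}).
Implicit Types (i j g : 'I_n) (L : seq (pm n)) (k : nat).

(** The two ways in which [gen g] exchanges a smaller entry P with a larger entry Q. *)
Definition gpair g P Q :=
  P = gp g /\ Q = gq g \/ P = neg (gq g) /\ Q = neg (gp g).

Lemma gpair_exists k Q : k.+1 < n -> k < rank Q < n.*2 - k ->
  exists g P, [/\ gpair g P Q, k <= rank P < rank Q,
    forall j, j < k -> gen g (pos j) = pos j &
    forall B, rank P < rank B < rank Q -> B = neg Q].
Proof.
move=> kn /andP[kQ Qk]; have QN := rank_lt Q.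
have fixg g : k <= g -> forall j, j < k -> gen g (pos j) = pos j.
  move=> kg j jk; apply: rank_inj; rewrite gen_exch rank_exch.
  have -> : rank (pos j) = j by [].
  by case: (rank_gpq n_gt1 g) => -[Hg -> ->]; rewrite !ifF //; lia.
have [rn|] := ltnP (rank Q) n.
  have Hg : (rank Q).-1 < n by lia.
  exists (Ordinal Hg), (gp (Ordinal Hg)).
  have [[/= _ pE qE]|[/= ? _ _]] := rank_gpq n_gt1 (Ordinal Hg); last by lia.
  have QE : Q = gq (Ordinal Hg) by apply: rank_inj; lia.
  split; [by left | lia | by apply: fixg => /=; lia |].
  by move=> B; rewrite pE; lia.
(* When Q is the first place past the middle, s_n carries it over the place in between, which is
   [neg Q]. In the other cases P immediately precedes Q. *)
rewrite leq_eqVlt => /orP[/eqP nE|nQ].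
  have Hg : n.-1 < n by lia.
  exists (Ordinal Hg), (gp (Ordinal Hg)).
  have [[/= ? _ _]|[/= _ pE qE]] := rank_gpq n_gt1 (Ordinal Hg); first by lia.
  have QE : Q = gq (Ordinal Hg) by apply: rank_inj; lia.
  split; [by left | lia | by apply: fixg => /=; lia |].
  by move=> B; rewrite pE => H; apply: rank_inj; rewrite rank_neg; lia.
have Hg : n.*2 - (rank Q).+1 < n by lia.
exists (Ordinal Hg), (neg (gq (Ordinal Hg))).
have [[/= _ pE qE]|[/= ? _ _]] := rank_gpq n_gt1 (Ordinal Hg); last by lia.
have QE : Q = neg (gp (Ordinal Hg)) by apply: rank_inj; rewrite rank_neg; lia.
split; [by right | rewrite rank_neg; lia | by apply: fixg => /=; lia |].
by move=> B; rewrite rank_neg qE; lia.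
Qed.

Lemma gpair_exch g P Q : gpair g P Q -> gen g = exch P Q.
Proof. by case=> -[-> ->]; rewrite ?exchNN ?gq_neq // gen_exch. Qed.

Lemma gpair_place g P Q v : gpair g P Q -> is_signed v ->
  (place v (gp g) < place v (gq g)) = (place v P < place v Q).
Proof.
case=> -[-> ->] // sv; rewrite !place_neg //.
by have := place_lt v (gp g); have := place_lt v (gq g); lia.
Qed.

Lemma gpair_rank g P Q v : gpair g P Q -> is_signed v ->
  (rank (v (gp g)) < rank (v (gq g))) = (rank (v P) < rank (v Q)).
Proof.
by move=> pq /signed_inv sv; have := gpair_place pq sv; rewrite /place invgK.
Qed.

Lemma gpair_neq g P Q : gpair g P Q -> Q != neg P.
Proof. by case=> -[-> ->]; rewrite ?negK 1?[neg _ == _]eq_sym gq_neq. Qed.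

Lemma gpair_flip g P Q A B : gpair g P Q -> B != neg A -> rank A < rank B ->
  rank (gen g B) < rank (gen g A) -> A = P /\ B = Q \/ A = neg Q /\ B = neg P.
Proof.
move=> pq BA AB; rewrite gen_lt // !xpair_eqE.
by case: pq => -[-> ->]; rewrite ?negK => /orP[] /andP[/eqP-> /eqP->]; auto.
Qed.

Section Step.

Variables (w u : {perm pm n}) (g : 'I_n) (P Q t x : pm n).
Hypotheses (sw : is_signed w) (pq : gpair g P Q).
Hypotheses (uE : u = scomp w (gen g)) (wP : w P = x) (wQ : w Q = t).

Let su : is_signed u.
Proof. by rewrite uE signed_scomp ?signed_gen. Qed.

Lemma place_step a : place u a = rank (gen g ((w^-1)%g a)).
Proof. by rewrite uE place_scomp /place gen_inv. Qed.

(** This is [gpair_flip] for the positions of a and b in w. *)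
Lemma flip_step a b : b != neg a -> place w a < place w b ->
  place u b < place u a -> a = x /\ b = t \/ a = neg t /\ b = neg x.
Proof.
move=> ba ab; rewrite !place_step => fl.
have ba' : (w^-1)%g b != neg ((w^-1)%g a).
  by rewrite -(signedP _ (signed_inv sw)) (inj_eq (@perm_inj _ _)).
case: (gpair_flip pq ba' ab fl) => -[aE bE]; [left|right].
  by rewrite -wP -wQ -aE -bE !permKV.
by rewrite -wP -wQ -!(signedP _ sw) -aE -bE !permKV.
Qed.

Lemma unflip_step a b : b != neg a -> place u a < place u b ->
  place w b < place w a -> a = t /\ b = x \/ a = neg x /\ b = neg t.
Proof.
move=> ba ab ba'; case: (@flip_step b a) => //.
  by rewrite -{1}(negK a) (inj_eq (can_inj (@negK n))) eq_sym.
  by case=> -> ->; left.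
by case=> -> ->; right.
Qed.

Lemma place_step_iff a b : a != t -> a != neg t -> b != t -> b != neg t ->
  b != neg a -> (place w a < place w b) = (place u a < place u b).
Proof.
move=> a1 a2 b1 b2 ba; apply/idP/idP => ab; rewrite ltnNge leq_eqVlt negb_or -place_eq.
  apply/andP; split; first by apply: contraTneq ab => ->; rewrite ltnn.
  by apply/negP => /(flip_step ba ab)[] [E1 E2]; move: a1 a2 b1 b2; rewrite ?E1 ?E2 eqxx.
apply/andP; split; first by apply: contraTneq ab => ->; rewrite ltnn.
by apply/negP => /(unflip_step ba ab)[] [E1 E2]; move: a1 a2 b1 b2; rewrite ?E1 ?E2 eqxx.
Qed.

(** The lifting at i only concerns entries different from t and -t, and the step changes the
    relative order of such entries only if they are opposite. *)
Lemma hop_lifting_step i z : is_signed z -> rank t < i ->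
  hop (pos i) (lifting w i) z = hop (pos i) (lifting u i) z.
Proof.
move=> sz ti; rewrite [RHS]hop_foldr ?neg_notin_lifting //.
apply: hop_lifting (pairwise_lifting i su) _ => //.
  apply: uniq_perm; rewrite ?uniq_lifting // => a; rewrite !mem_lifting //.
  case: (boolP (_ < _ < _)) => //= /andP[ia ai].
  have iN := ltn_ord i.
  apply: place_step_iff; rewrite rank_eq ?rank_neg; apply/eqP;
    rewrite -?[rank (pos i)]/(i : nat); lia.
move=> a b; rewrite !mem_lifting // => /andP[/andP[ia ai] _] /andP[/andP[ib bi] _] ab ba.
apply/eqP/negPn/negP => nab; move: ba.
rewrite ltnNge leq_eqVlt negb_or -place_step_iff ?ab ?andbF //.
all: rewrite rank_eq ?rank_neg; apply/eqP; lia.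
Qed.

Lemma hop_lifting_gen_star i v : t = pos i -> i < rank x < n.*2 - i.+1 ->
  rank P < rank Q -> (forall B, rank P < rank B < rank Q -> B = neg Q) ->
  v \in Dn n ->
  hop t (lifting w i) (scomp w v) =
  hop t (lifting u i) (scomp u (gen_star g v)).
Proof.
move=> tE rx PQ mid vD; have iN := ltn_ord i.
have sv := Dn_signed vD.
have rt : rank t = i by rewrite tE.
have xt : x != t by rewrite rank_eq rt; apply/eqP; lia.
have xnt : x != neg t by rewrite rank_eq rank_neg rt; apply/eqP; lia.
have placewx : place w x = rank P by rewrite -wP place_app.
have placewt : place w t = rank Q by rewrite -wQ place_app.
have placeux : place u x = rank Q by rewrite place_step -wP permK (gpair_exch pq) exchL.
have placeut : place u t = rank P by rewrite place_step -wQ permK (gpair_exch pq) exchR.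
have neq_t a : i < rank a < n.*2 - i.+1 -> a != t /\ a != neg t.
  by move=> ra; split; rewrite rank_eq ?rank_neg rt; apply/eqP; lia.
(* The order of [lifting u i] followed by x. As [foldr] starts from the end of the list, the hop
   over x comes first. *)
pose r a b := (a != x) && ((b == x) || (place u a < place u b)).
have xu : x \notin lifting u i.
  by rewrite mem_lifting // -tE placeux placeut (ltnNge (rank Q)) (ltnW PQ) andbF.
rewrite {1}tE (hop_lifting (L := lifting u i ++ [:: x]) (r := r)) //.
- rewrite foldr_cat /= hop_foldr ?tE ?neg_notin_lifting ?signed_scomp //.
    congr (foldr _ _ _).
    rewrite /hop1 {1}/pmlt -tE rt (andP rx).1 /= !place_scomp.
    rewrite -/(place v _) -/(place v _).
    have -> : (w^-1)%g t = Q by rewrite -wQ permK.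
    have -> : (w^-1)%g x = P by rewrite -wP permK.
    rewrite gen_starE // (gpair_place pq sv).
    have QP : Q != P by rewrite rank_eq; apply/eqP; lia.
    (* If [gen g] lengthens v, then x precedes t in wv, no hop occurs, and [gen g] cancels in the
       right-hand side. Otherwise t hops over x, which amounts to replacing w by u. *)
    have [lt_PQ|] := ltnP (place v P).
      by rewrite ltnNge ltnW //= uE scompA scompKg.
    rewrite leq_eqVlt -place_eq (negbTE QP) /= => ->.
    rewrite uE (gpair_exch pq); apply/permP => c.
    by rewrite !scompE exch_conj // wP wQ exchC.
  by apply: Dn_signed; apply: Dn_gen_star.
- by rewrite signed_scomp.
- apply: uniq_perm; rewrite ?uniq_lifting //.
    by rewrite cats1 rcons_uniq xu uniq_lifting.
  move=> a; rewrite mem_cat inE !mem_lifting // -tE.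
  have [->|ax] := eqVneq a x; first by rewrite rx placewx placewt PQ orbT.
  rewrite orbF; case: (boolP (_ < _ < _)) => //= /neq_t[at_ ant].
  have nat_ : t != neg a by apply: contra ant => /eqP ->; rewrite negK.
  apply/idP/idP => lt_at; rewrite ltnNge leq_eqVlt negb_or -place_eq eq_sym at_ /=.
    apply/negP => /(flip_step nat_ lt_at)[] [E1 E2].
      by rewrite E1 eqxx in ax.
    by rewrite E1 eqxx in ant.
  apply/negP => /(unflip_step nat_ lt_at)[] [E1 E2].
    by rewrite E1 eqxx in at_.
  by move: (neg_neq t); rewrite -E2 eqxx.
- rewrite pairwise_cat /= andbT; apply/andP; split.
    rewrite allrel_consr; apply/andP; split; last by elim: (lifting u i).
    by apply/allP => a al; rewrite /r eqxx andbT; apply: contraNneq xu => <-.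
  apply: (sub_in_pairwise (P := predC1 x)) (pairwise_lifting i su).
    by move=> a b ax _; rewrite /r => ->; rewrite orbT andbT.
  by apply/allP => a al /=; apply: contraNneq xu => <-.
move=> a b; rewrite !mem_lifting // -tE.
move=> /andP[/neq_t[a1 a2] aw] /andP[/neq_t[b1 b2] bw] lt_ab /andP[bx].
rewrite eq_sym; have [ax _|_ /= ba] := eqVneq x a.
  (* An entry b strictly between x and t in w sits at [neg Q], so it is -t, which is not in the
     lifting. *)
  have /mid bE : rank P < rank ((w^-1)%g b) < rank Q.
    by rewrite -/(place w b) -placewx -placewt ax lt_ab bw.
  by move: b2; rewrite -[b](permKV w) bE (signedP _ sw) wQ eqxx.
apply/eqP/negPn/negP => nab; move: ba.
by rewrite ltnNge leq_eqVlt negb_or -place_step_iff ?lt_ab ?andbF.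
Qed.

End Step.

(** * Induction on the fixed entries and on the place of the next one *)

Lemma demazure_hop k w v : k < n -> w \in Dn n -> v \in Dn n ->
  (forall j, j < k -> w (pos j) = pos j) ->
  demazure w v =
  foldl (fun z i => hop (pos i) (lifting w i) z) (scomp w v)
        [seq i : 'I_n <- enum 'I_n | k <= i & i.+1 < n].
Proof.
move: {2}(n - k) (leqnn (n - k)) => m; elim: m k w v => [|m IHm] k w v; first by lia.
move=> km kn wD vD fixw.
have [kn'|nk] := ltnP k.+1 n; last first.
  (* Here k is n-1. Every [gp g] is among the entries fixed by w, so w has no right descent. *)
  have -> : w = 1%g.
    apply: no_descent_id => // g.
    have pk : rank (gp g) < k by case: (rank_gpq n_gt1 g) => -[? -> _]; lia.
    rewrite (fixed_app (ltnW kn) fixw pk); have := rank_gp_lt n_gt1 g.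
    have [qk|] := ltnP (rank (w (gq g))) k; last by lia.
    move: (qk); rewrite -(fixed_place _ (ltnW kn) fixw) place_app => qk'.
    by rewrite (fixed_app (ltnW kn) fixw qk').
  rewrite demazure1 // /scomp mulg1.
  suff -> : [seq i : 'I_n <- enum 'I_n | k <= i & i.+1 < n] = [::] by [].
  by rewrite -(filter_pred0 (enum 'I_n)); apply: eq_filter => i /=; lia.
rewrite ord_filterS /=; set o := Ordinal _; have oE : o = k :> nat by [].
have [p] := ubnP (place w (pos o)); elim: p w v wD vD fixw => // p IHp w v wD vD fixw wp.
have sw := Dn_signed wD.
have fixp := fixed_place _ (ltnW kn) fixw.
have [kp|] := ltnP k (place w (pos o)); last first.
  (* The entry is already at its own place k. The lifting there is empty, since the places before k
     hold only smaller entries, and the outer induction applies. *)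
  rewrite leq_eqVlt fixp ltnn orbF => /eqP place_o.
  have fixw' j : j < k.+1 -> w (pos j) = pos j.
    rewrite ltnS leq_eqVlt => /orP[/eqP jk|]; last exact: fixw.
    have -> : j = o by apply: val_inj.
    have E : (w^-1)%g (pos o) = pos o by apply: rank_inj; exact: place_o.
    by rewrite -{1}E permKV.
  rewrite (IHm k.+1) //; last by lia.
  congr (foldl _ _ _); rewrite hop_foldr ?neg_notin_lifting ?signed_scomp ?Dn_signed //.
  case E: (lifting w o) => [//|a L]; have: a \in lifting w o by rewrite E mem_head.
  rewrite mem_lifting // place_o fixp => /andP[/andP[+ _]]; lia.
have sg := signed_gen.
(* The first k places hold 1, ..., k and so not the opposite of [pos o]; by symmetry [pos o] is not
   among the last k places. *)
have lt_Q : rank ((w^-1)%g (pos o)) < n.*2 - k.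
  have := fixp (neg (pos o)); rewrite place_neg // rank_neg /place /rank /=.
  by have := rank_lt ((w^-1)%g (pos o)); rewrite /rank; lia.
have [|g [P [pq /andP[kP PQ] fixg mid]]] := @gpair_exists k ((w^-1)%g (pos o)) kn'.
  by rewrite lt_Q andbT.
set Q := (w^-1)%g (pos o) in lt_Q pq PQ mid.
have wQ : w Q = pos o by rewrite permKV.
pose u := scomp w (gen g).
have uD : u \in Dn n by rewrite Dn_scomp ?Dn_gen.
have fixu j : j < k -> u (pos j) = pos j by move=> jk; rewrite scompE fixg ?fixw.
(* The entry exchanged with [pos o] is neither one of the fixed entries or their opposites nor
   [pos o] or its opposite. *)
have rx : o < rank (w P) < n.*2 - o.+1.
  have := fixp (w P); have := fixp (neg (w P)).
  rewrite place_neg // place_app rank_neg /=.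
  have : rank (w P) != rank (w Q).
    by rewrite -rank_eq (inj_eq (@perm_inj _ _)) rank_eq; apply/eqP; lia.
  have : rank (w P) != rank (w (neg Q)).
    rewrite -rank_eq (inj_eq (@perm_inj _ _)).
    by apply: contra (gpair_neq pq) => /eqP ->; rewrite negK.
  rewrite (signedP _ sw) wQ rank_neg -[rank (pos o)]/k.
  by have := rank_lt (w P); have := rank_lt Q; lia.
have uP : u P = pos o by rewrite scompE (gpair_exch pq) exchL.
have lt_u : rank (u (gp g)) < rank (u (gq g)).
  rewrite (gpair_rank pq) ?Dn_signed // uP scompE (gpair_exch pq) exchR.
  by case/andP: rx.
(* The inner induction applies to u, where [pos o] is at the smaller place P, with [gen_star g v] in
   place of v. *)
rewrite -[in LHS](scompKg g w) -/u demazure_gen // IHp //; first last.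
- by rewrite /place -uP permK; exact: leq_trans PQ _.
- exact: Dn_gen_star.
have su := Dn_signed uD.
rewrite -(hop_lifting_gen_star sw pq erefl erefl wQ erefl) //.
set z := hop _ _ _; have sz : is_signed z by rewrite signed_hop ?signed_scomp ?Dn_signed.
have: all (fun i : 'I_n => k < i) [seq i : 'I_n <- enum 'I_n | k < i & i.+1 < n].
  by apply/allP => i; rewrite mem_filter => /andP[/andP[]].
elim: [seq _ <- _ | _] z sz => //= i L IHL z sz /andP[ki kL].
rewrite (hop_lifting_step sw pq erefl erefl wQ) // IHL // signed_hop //.
Qed.

End Main.

(* [i : 'I_n] stands for the integer i+1; the fold applies the operators for
   1, 2, ..., n-1 in this order, so that of n-1 is the outermost. *)
Theorem mainTheorem1 (n : nat) (hn : 2 <= n) (w v : {perm pm n})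
    (hw : w \in Dn n) (hv : v \in Dn n) :
  demazure w v =
  foldl (fun (u : {perm pm n}) (i : 'I_n) => hop (pos i) (lifting w i) u)
        (scomp w v) [seq i : 'I_n <- enum 'I_n | i.+1 < n].
Proof. by rewrite (@demazure_hop n hn 0) //; lia. Qed.
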